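(* Let $K_2$ be the virtual knot $4.21$ of Green's table of virtual knots and let $G(K_2)=G_A(K_2)$ be its group. Then the length of the lower central series of $G(K_2)$ is greater than or equal to $5$ and less than or equal to $\omega^2$.
   Context: Notation: $x^{y}=y^{-1}xy$, $[x,y]=x^{-1}y^{-1}xy$. The transfinite lower central series of a group $G$ is defined by $\gamma_1(G)=G$, $\gamma_{\alpha+1}(G)=\langle [g_\alpha,g] : g_\alpha\in\gamma_\alpha(G), g\in G\rangle$, and $\gamma_\alpha(G)=\bigcap_{\beta<\alpha}\gamma_\beta(G)$ for limit ordinals $\alpha$; $\omega$ is the first infinite ordinal. The length of the lower central series is the maximal ordinal $\alpha$ such that $\gamma_\alpha(G)\ne\gamma_{\alpha+1}(G)$; ''length $\ge\lambda$'' is understood to mean that $\gamma_\alpha(G)\neq\gamma_{\alpha+1}(G)$ for some ordinal $\alpha\ge\lambda$, and ''length $\le\lambda$'' that $\gamma_\alpha(G)=\gamma_{\alpha+1}(G)$ for every ordinal $\alpha>\lambda$. The group $G_A(K)$ of a virtual knot $K$ is computed from a diagram: the diagram is divided into arcs running from one crossing (real or virtual) to the next, each arc gets a generator, there is one extra generator $y$, each real crossing gives a Wirtinger-type relation, and at each virtual crossing the generators on the two sides of the crossing along a strand are related by conjugation by $y^{\pm1}$. For the diagram of $K_2$ used here this group is $$G(K_2)=\langle x_1,\dots,x_{14},y\mid x_5x_{12}=x_{12}x_6,\ x_2x_{12}=x_{13}x_2,\ x_7x_3=x_3x_8,\ x_9x_1=x_1x_{10},\ x_3=x_2^{y},\ x_6=x_7^{y},\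 x_{12}=x_{11}^{y},$$ $$x_4=x_5^{y},\ x_{14}=x_{13}^{y},\ x_1=x_2^{y},\ x_4=x_3^{y},\ x_8=x_9^{y},\ x_1=x_{14}^{y},\ x_{10}=x_{11}^{y}\rangle,$$ and this presentation may be taken as the definition of $G(K_2)$. *)

(* Defs.v *)
From HB Require Import structures.
From mathcomp Require Import all_boot.
From mathcomp Require Import boolp classical_sets.

Set Implicit Arguments.
Unset Strict Implicit.
Unset Printing Implicit Defensive.

Local Open Scope classical_set_scope.
Local Open Scope group_scope.

Record ordnum := Ordnum {
  ord_sort :> Type;
  ord_lt : ord_sort -> ord_sort -> Prop;
  ord_lt_wf : well_founded ord_lt;
  ord_lt_trans : forall y x z, ord_lt x y -> ord_lt y z -> ord_lt x z;
  ord_lt_total : forall x y, [\/ ord_lt x y, x = y | ord_lt y x] }.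

Notation "x ≺ y" := (ord_lt x y) (at level 70, no associativity).

Definition ord_mono (a b : ordnum) (f : a -> b) := forall x y, x ≺ y -> f x ≺ f y.

(* [a] is isomorphic to an initial segment of [b] (possibly [b] itself). *)
Definition ordnum_le (a b : ordnum) :=
  exists2 f : a -> b, ord_mono f & forall x z, z ≺ f x -> range f z.

(* [a] is isomorphic to the proper initial segment of [b] cut by [m]. *)
Definition ordnum_lt (a b : ordnum) :=
  exists (f : a -> b) (m : b), ord_mono f /\ forall z, z ≺ m <-> range f z.

Lemma ord_lt_irr (a : ordnum) (x : a) : ~ x ≺ x.
Proof. by elim: (ord_lt_wf x) => y _ IH yy; exact: (IH y yy yy). Qed.

Definition fin_lt n (i j : 'I_n) : Prop := (i < j)%N.

Lemma nat_lt_wf : well_founded (fun m n : nat => (m < n)%N : Prop).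
Proof.
have aux k : forall n, (n < k)%N -> Acc (fun m n : nat => (m < n)%N : Prop) n.
  elim: k => [n|k IH n nk]; first by rewrite ltn0.
  by constructor=> m mn; apply: IH; exact: leq_trans mn nk.
by move=> n; exact: (aux n.+1 n (ltnSn n)).
Qed.

Lemma fin_lt_wf n : well_founded (@fin_lt n).
Proof.
have aux k : forall i : 'I_n, (i < k)%N -> Acc (@fin_lt n) i.
  elim: k => [i|k IH i ik]; first by rewrite ltn0.
  by constructor=> j ji; apply: IH; exact: leq_trans ji ik.
by move=> i; exact: (aux i.+1 i (ltnSn i)).
Qed.

Lemma fin_lt_trans n (y x z : 'I_n) : fin_lt x y -> fin_lt y z -> fin_lt x z.
Proof. exact: ltn_trans. Qed.

Lemma fin_lt_total n (x y : 'I_n) : [\/ fin_lt x y, x = y | fin_lt y x].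
Proof.
rewrite /fin_lt; case: (ltngtP x y) => [xy|yx|/val_inj xy].
- exact: Or31.
- exact: Or33.
- exact: Or32.
Qed.

Definition ord_fin n := Ordnum (@fin_lt_wf n) (@fin_lt_trans n) (@fin_lt_total n).

Lemma nat_lt_total (x y : nat) : [\/ (x < y)%N : Prop, x = y | (y < x)%N : Prop].
Proof. by case: (ltngtP x y) => xy; [exact: Or31|exact: Or33|exact: Or32]. Qed.

Definition ord_omega : ordnum :=
  Ordnum nat_lt_wf (fun y x z => @ltn_trans y x z) nat_lt_total.

(* The product [a * b] is [b] copies of [a]: the second component dominates. *)
Definition mul_lt (a b : ordnum) (p q : a * b) : Prop :=
  p.2 ≺ q.2 \/ p.2 = q.2 /\ p.1 ≺ q.1.

Lemma mul_lt_wf a b : well_founded (@mul_lt a b).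
Proof.
case=> x y; elim: (ord_lt_wf y) x => {}y _ IHy x.
elim: (ord_lt_wf x) => {}x _ IHx; constructor=> -[x' y'] [/= /IHy //|/=].
by case=> -> /IHx.
Qed.

Lemma mul_lt_trans (a b : ordnum) (q p r : a * b) : mul_lt p q -> mul_lt q r -> mul_lt p r.
Proof.
move=> [pq|[e pq]] [qr|[e' qr]]; rewrite /mul_lt.
- by left; exact: ord_lt_trans pq qr.
- by left; rewrite -e'.
- by left; rewrite e.
- by right; rewrite e; split=> //; exact: ord_lt_trans pq qr.
Qed.

Lemma mul_lt_total (a b : ordnum) (p q : a * b) : [\/ mul_lt p q, p = q | mul_lt q p].
Proof.
case: p q => [x y] [x' y']; rewrite /mul_lt /=.
case: (ord_lt_total y y') => [lt|->|lt]; [by apply: Or31; left| |by apply: Or33; left].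
case: (ord_lt_total x x') => [lt|->|lt]; first by apply: Or31; right.
  exact: Or32.
by apply: Or33; right.
Qed.

Definition ord_mul a b :=
  Ordnum (@mul_lt_wf a b) (@mul_lt_trans a b) (@mul_lt_total a b).

(* [a + 1]: a new largest element [None] is added. *)
Definition succ_lt (a : ordnum) (x y : option a) : Prop :=
  match x, y with
  | Some x, Some y => x ≺ y
  | Some _, None => True
  | None, _ => False
  end.

Lemma succ_lt_wf a : well_founded (@succ_lt a).
Proof.
have accS (x : a) : Acc (@succ_lt a) (Some x).
  by elim: (ord_lt_wf x) => {}x _ IH; constructor=> -[y /IH|[]].
case=> [x|]; first exact: accS.
by constructor=> -[x _|[]]; exact: accS.
Qed.

Lemma succ_lt_trans (a : ordnum) (y x z : option a) :
  succ_lt x y -> succ_lt y z -> succ_lt x z.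
Proof. by case: x y z => [x|] [y|] [z|] //=; exact: ord_lt_trans. Qed.

Lemma succ_lt_total (a : ordnum) (x y : option a) : [\/ succ_lt x y, x = y | succ_lt y x].
Proof.
case: x y => [x|] [y|] /=; [|exact: Or31|exact: Or33|exact: Or32].
by case: (ord_lt_total x y) => [|->|]; [exact: Or31|exact: Or32|exact: Or33].
Qed.

Definition ord_succ a :=
  Ordnum (@succ_lt_wf a) (@succ_lt_trans a) (@succ_lt_total a).

Definition subgroup_gen (G : groupType) (S : set G) : set G :=
  smallest [set H : set G | group_closed [in H]] S.

Definition comm_gen (G : groupType) (A : set G) : set G :=
  subgroup_gen [set [~ a, g] | a in A & g in [set: G]].

(* An element of an ordinal stands for the ordinal of its predecessors. *)
Definition ord_is0 (a : ordnum) (v : a) := forall u, ~ u ≺ v.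

Definition ord_covers (a : ordnum) (v w : a) :=
  v ≺ w /\ forall u, u ≺ w -> u = v \/ u ≺ v.

Definition ord_limit (a : ordnum) (w : a) :=
  ~ ord_is0 w /\ forall v, ~ ord_covers v w.

(* The value at [w], given the values [F] below [w]; each clause is vacuous
   unless [w] is of the corresponding kind.  The series starts at index 1: no
   clause applies to 0 and 1, where the value is the whole group. *)
Definition lcs_step (G : groupType) (a : ordnum) (w : a)
    (F : forall v, v ≺ w -> set G) : set G :=
  [set g | (forall v (vw : v ≺ w),
              ord_covers v w -> ~ ord_is0 v -> comm_gen (F v vw) g)
        /\ (ord_limit w -> forall v (vw : v ≺ w), F v vw g)].

Definition lcs_at (G : groupType) (a : ordnum) : a -> set G :=
  Fix (@ord_lt_wf a) (fun=> set G) (@lcs_step G a).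
Arguments lcs_at G {a} w.

Definition lcs (G : groupType) (a : ordnum) : set G :=
  lcs_at G (None : ord_succ a).
Arguments lcs G a : clear implicits.

Definition lcs_length_ge (G : groupType) (l : ordnum) :=
  exists2 a : ordnum, ordnum_le l a & lcs G a <> lcs G (ord_succ a).

Definition lcs_length_le (G : groupType) (l : ordnum) :=
  forall a : ordnum, ordnum_lt l a -> lcs G a = lcs G (ord_succ a).

Lemma lcs_atE (G : groupType) (a : ordnum) (w : a) :
  lcs_at G w = lcs_step (fun v (_ : v ≺ w) => lcs_at G v).
Proof.
rewrite /lcs_at Fix_eq // => x f g fg; congr lcs_step.
by apply: functional_extensionality_dep => y; apply: functional_extensionality_dep.
Qed.

Lemma initial_is0 (a b : ordnum) (f : a -> b) :
    ord_mono f -> (forall x z, z ≺ f x -> range f z) ->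
  forall x, ord_is0 (f x) <-> ord_is0 x.
Proof.
move=> fm fi x; split=> x0 u ux; first exact: (x0 (f u) (fm _ _ ux)).
have [t _ tu] := fi _ _ ux; subst u.
case: (ord_lt_total t x) => [/x0 //|e|/fm xt]; first by rewrite e in ux; exact: ord_lt_irr ux.
exact: ord_lt_irr (ord_lt_trans ux xt).
Qed.

Lemma initial_lt (a b : ordnum) (f : a -> b) : ord_mono f ->
  forall x y, f x ≺ f y -> x ≺ y.
Proof.
move=> fm x y fxy; case: (ord_lt_total x y) => // [e|/fm yx].
  by case: (@ord_lt_irr b (f y)); rewrite -{1}e.
by case: (@ord_lt_irr b (f x)); exact: ord_lt_trans fxy yx.
Qed.

Lemma initial_covers (a b : ordnum) (f : a -> b) :
    ord_mono f -> (forall x z, z ≺ f x -> range f z) ->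
  forall x y, ord_covers (f x) (f y) <-> ord_covers x y.
Proof.
move=> fm fi x y; split=> -[xy m]; split.
- exact: initial_lt xy.
- move=> u uy; case: (ord_lt_total u x) => [|->|xu]; [by right|by left|].
  case: (m _ (fm _ _ uy)) => [e|/(initial_lt fm) ux]; last by right.
  by case: (@ord_lt_irr b (f x)); rewrite -{2}e; exact: fm.
- exact: fm.
- move=> u uy; have [t _ tu] := fi _ _ uy; subst u.
  by case: (m t (initial_lt fm uy)) => [->|/fm]; [left|right].
Qed.

Lemma lcs_at_initial (G : groupType) (a b : ordnum) (f : a -> b) :
    ord_mono f -> (forall x z, z ≺ f x -> range f z) ->
  forall x, lcs_at G (f x) = lcs_at G x.
Proof.
move=> fm fi x; elim: (ord_lt_wf x) => {}x _ IH; rewrite !lcs_atE.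
have fiE := initial_covers fm fi.
have lim : ord_limit (f x) <-> ord_limit x.
  rewrite /ord_limit (initial_is0 fm fi); split=> -[x0 m]; split=> // v c.
    by apply: (m (f v)); rewrite fiE.
  have [t _ tv] := fi _ _ (proj1 c); subst v.
  by apply: (m t); rewrite -fiE.
apply/seteqP; split=> g [gS gL]; split.
- move=> v vx c v0; rewrite -IH //; apply: gS; [exact: fm|by rewrite fiE|].
  by rewrite (initial_is0 fm fi).
- move=> l v vx; rewrite -IH //; apply: gL; [by rewrite lim|exact: fm].
- move=> v vx c v0; have [t _ tv] := fi _ _ vx; subst v.
  have tx := initial_lt fm vx; rewrite IH //; apply: gS => //; first by rewrite -fiE.
  by rewrite -(initial_is0 fm fi).
- move=> l v vx; have [t _ tv] := fi _ _ vx; subst v.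
  by have tx := initial_lt fm vx; rewrite IH //; apply: gL => //; rewrite -lim.
Qed.

Lemma lcs1 (G : groupType) : lcs G (ord_fin 1) = [set: G].
Proof.
apply/seteqP; split=> // g _; rewrite /lcs lcs_atE; split.
  move=> [v|//] _ _ []; case=> [u|//]; rewrite /= /fin_lt.
  by rewrite !ord1.
move=> [_ /(_ (Some ord0))[]]; split=> //.
by case=> [u|//] _; left; rewrite ord1.
Qed.

Lemma lcs_succ (G : groupType) (a : ordnum) (x : a) : lcs G (ord_succ a) = comm_gen (lcs G a).
Proof.
have E : lcs_at G (Some None : ord_succ (ord_succ a)) = lcs G a.
  by apply: (@lcs_at_initial _ (ord_succ a)) => // y [z|//] _; exists z.
rewrite -E /lcs lcs_atE.
have c : ord_covers (Some None : ord_succ (ord_succ a)) None.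
  split=> // -[[u|]|//] _; [by right|by left].
apply/seteqP; split=> g.
  by move=> [/(_ (Some None) I c) + _]; apply=> /(_ (Some (Some x))); exact.
move=> gc; split; last by move=> [_ /(_ _ c)].
move=> v vw [_ vm] _; case: (vm _ (proj1 c)) => [<-//|].
by case: v vw {vm} => [[v|]|].
Qed.

Definition ord_is_limit (a : ordnum) :=
  inhabited a /\ forall x : a, exists y, x ≺ y.

Lemma lcs_lim (G : groupType) (a : ordnum) : ord_is_limit a ->
  lcs G a = [set g | forall b, ordnum_lt b a -> lcs G b g].
Proof.
move=> [[x0] amax].
have lim : ord_limit (None : ord_succ a).
  split=> [/(_ (Some x0))/(_ I) //|[v|] []//= _ vm].
  have [y vy] := amax v; case: (vm (Some y) I) => [[e]|/= yv].
    by rewrite e in vy; exact: ord_lt_irr vy.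
  exact: ord_lt_irr (ord_lt_trans vy yv).
have E (b : ordnum) (f : b -> a) (m : a) : ord_mono f ->
    (forall z, z ≺ m <-> range f z) -> lcs_at G (Some m : ord_succ a) = lcs G b.
  move=> fm fr; pose h (y : ord_succ b) : ord_succ a :=
    Some (if y is Some y then f y else m).
  have fm' y : f y ≺ m by apply/fr; exists y.
  rewrite -[Some m]/(h None); apply: (@lcs_at_initial _ (ord_succ b)).
    by move=> [y|] [z|] //= yz; exact: fm.
  move=> y [z|] //= zy.
  have /fr[t _ <-] : z ≺ m.
    by case: y zy => //= y zy; exact: ord_lt_trans zy (fm' y).
  by exists (Some t).
apply/seteqP; split=> g.
  rewrite {1}/lcs lcs_atE => -[_ /(_ lim) gl] b [f [m [fm fr]]].
  by rewrite -(E b f m) //; apply: gl.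
move=> gb; rewrite /lcs lcs_atE; split; first by move=> v _ /(proj2 lim).
move=> _ [m|//] _.
pose T := {x : a | x ≺ m}; pose ltT (x y : T) := sval x ≺ sval y.
have Twf : well_founded ltT.
  case=> x xm; elim: (ord_lt_wf x) xm => {}x _ IH xm.
  by constructor=> -[y ym]; rewrite /ltT /= => yx; exact: (IH y yx ym).
have Ttr (y x z : T) : ltT x y -> ltT y z -> ltT x z by exact: ord_lt_trans.
have Tto (x y : T) : [\/ ltT x y, x = y | ltT y x].
  case: (ord_lt_total (sval x) (sval y)) => [|e|]; [exact: Or31| |exact: Or33].
  by apply: Or32; case: x y e => [x xm] [y ym] /= e; exact: eq_exist.
pose b := Ordnum Twf Ttr Tto.
have bm z : z ≺ m <-> range (sval : b -> a) z.
  by split=> [zm|[[t tm] _ <-]//]; exists (exist _ z zm).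
rewrite (@E b sval m) //; apply: gb; exists sval, m; split=> //.
Qed.

Inductive word (X : Type) :=
  | Gen of X
  | WOne
  | WInv of word X
  | WMul of word X & word X.
Arguments WOne {X}.

HB.instance Definition _ X := gen_eqMixin (word X).
HB.instance Definition _ X := gen_choiceMixin (word X).
(* Gives formal words the group_scope notations (no group law is claimed). *)
HB.instance Definition _ X := hasMul.Build (word X) (@WMul X).
HB.instance Definition _ X := hasOne.Build (word X) (@WOne X).
HB.instance Definition _ X := hasInv.Build (word X) (@WInv X).

(* A pair [(u, v)] in [R] is the relation [u = v]. *)
Inductive pres_eq (X : Type) (R : seq (word X * word X)) :
    word X -> word X -> Prop :=
  | PRel u v : (u, v) \in R -> pres_eq R u v
  | PRefl u : pres_eq R u u
  | PSym u v : pres_eq R u v -> pres_eq R v u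
  | PTrans v u w : pres_eq R u v -> pres_eq R v w -> pres_eq R u w
  | PMul u u' v v' : pres_eq R u u' -> pres_eq R v v' -> pres_eq R (u * v) (u' * v')
  | PInv u u' : pres_eq R u u' -> pres_eq R u^-1 u'^-1
  | PAssoc u v w : pres_eq R (u * (v * w)) (u * v * w)
  | P1l u : pres_eq R (1 * u) u
  | P1r u : pres_eq R (u * 1) u
  | PVl u : pres_eq R (u^-1 * u) 1
  | PVr u : pres_eq R (u * u^-1) 1.

Section Presentation.
Variables (X : Type) (R : seq (word X * word X)).

Definition pres_eqb : rel (word X) := fun u v => `[< pres_eq R u v >].

Lemma pres_eqb_refl : reflexive pres_eqb.
Proof. by move=> u; apply/asboolP; exact: PRefl. Qed.

Lemma pres_eqb_sym : symmetric pres_eqb.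
Proof. by move=> u v; apply/asbool_equiv_eq; split; exact: PSym. Qed.

Lemma pres_eqb_trans : transitive pres_eqb.
Proof.
by move=> v u w /asboolP uv /asboolP vw; apply/asboolP; exact: PTrans uv vw.
Qed.

Canonical pres_equiv := EquivRel pres_eqb pres_eqb_refl pres_eqb_sym pres_eqb_trans.

Definition presented := {eq_quot pres_equiv}%qT.
HB.instance Definition _ := Choice.on presented.

Definition pres_class (u : word X) : presented := (\pi_presented u)%qT.

Lemma pres_classP u v : pres_class u = pres_class v <-> pres_eq R u v.
Proof.
by split=> [/eqP|uv]; [rewrite eqmodE => /asboolP|apply/eqP; rewrite eqmodE; apply/asboolP].
Qed.

Lemma pres_repr (g : presented) : pres_class (repr g) = g.
Proof. exact: reprK. Qed.

Definition pres_mul (g h : presented) := pres_class (repr g * repr h).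
Definition pres_inv (g : presented) := pres_class (repr g)^-1.

Lemma pres_mulE u v : pres_mul (pres_class u) (pres_class v) = pres_class (u * v).
Proof. by apply/pres_classP; apply: PMul; apply/pres_classP; rewrite pres_repr. Qed.

Lemma pres_invE u : pres_inv (pres_class u) = pres_class u^-1.
Proof. by apply/pres_classP; apply: PInv; apply/pres_classP; rewrite pres_repr. Qed.

Lemma pres_mulA : associative pres_mul.
Proof.
move=> a b c; rewrite -(pres_repr a) -(pres_repr b) -(pres_repr c) !pres_mulE.
by apply/pres_classP; exact: PAssoc.
Qed.

Lemma pres_mul1g : left_id (pres_class 1) pres_mul.
Proof. by move=> a; rewrite -(pres_repr a) pres_mulE; apply/pres_classP; exact: P1l. Qed.

Lemma pres_mulg1 : right_id (pres_class 1) pres_mul.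
Proof. by move=> a; rewrite -(pres_repr a) pres_mulE; apply/pres_classP; exact: P1r. Qed.

Lemma pres_mulVg : left_inverse (pres_class 1) pres_inv pres_mul.
Proof.
move=> a; rewrite -(pres_repr a) pres_invE pres_mulE.
by apply/pres_classP; exact: PVl.
Qed.

Lemma pres_mulgV : right_inverse (pres_class 1) pres_inv pres_mul.
Proof.
move=> a; rewrite -(pres_repr a) pres_invE pres_mulE.
by apply/pres_classP; exact: PVr.
Qed.

HB.instance Definition _ :=
  isGroup.Build presented pres_mulA pres_mul1g pres_mulg1 pres_mulVg pres_mulgV.

End Presentation.

Fixpoint word_eval (X : Type) (H : groupType) (f : X -> H) (u : word X) : H :=
  match u with
  | Gen x => f x
  | WOne => 1
  | WInv v => (word_eval f v)^-1
  | WMul v w => word_eval f v * word_eval f w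
  end.

Lemma presented_rel X (R : seq (word X * word X)) u v :
  (u, v) \in R -> pres_class R u = pres_class R v.
Proof. by move=> uv; apply/pres_classP; exact: PRel. Qed.

Lemma pres_class_eval X (R : seq (word X * word X)) u :
  pres_class R u = word_eval (fun x => pres_class R (Gen x)) u.
Proof.
elim: u => //= [u <-|u <- v <-]; first exact/esym/pres_invE.
exact/esym/pres_mulE.
Qed.

Lemma presented_lift X (R : seq (word X * word X)) (H : groupType) (f : X -> H) :
    (forall u v, (u, v) \in R -> word_eval f u = word_eval f v) ->
  exists2 phi : presented R -> H,
    {morph phi : g h / g * h} & forall x, phi (pres_class R (Gen x)) = f x.
Proof.
move=> fR.
have fE u v : pres_eq R u v -> word_eval f u = word_eval f v.
  elim=> /= [u0 v0 /fR|u0|u0 v0 _ ->|v0 u0 w0 _ -> _ ->|u0 u1 v0 v1 _ -> _ ->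
    |u0 u1 _ ->|u0 v0 w0|u0|u0|u0|u0] //.
  - by rewrite mulgA.
  - by rewrite mul1g.
  - by rewrite mulg1.
  - by rewrite mulVg.
  - by rewrite mulgV.
have phiE u : word_eval f (repr (pres_class R u)) = word_eval f u.
  by apply: fE; apply/pres_classP; exact: pres_repr.
exists (fun g => word_eval f (repr g)) => [g h|x]; last by rewrite phiE.
by rewrite -[g * h]/(pres_class R (repr g * repr h)) phiE.
Qed.

(* Of the 15 generators, number 0 is [y] and number [i] is [x_i]. *)
Definition K2_x (i : nat) : word 'I_15 := Gen (inord i).
Definition K2_y : word 'I_15 := Gen ord0.

Local Notation x := K2_x.
Local Notation y := K2_y.

Definition K2_relations : seq (word 'I_15 * word 'I_15) :=
  [:: (x 5 * x 12, x 12 * x 6);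
      (x 2 * x 12, x 13 * x 2);
      (x 7 * x 3, x 3 * x 8);
      (x 9 * x 1, x 1 * x 10);
      (x 3, x 2 ^ y);
      (x 6, x 7 ^ y);
      (x 12, x 11 ^ y);
      (x 4, x 5 ^ y);
      (x 14, x 13 ^ y);
      (x 1, x 2 ^ y);
      (x 4, x 3 ^ y);
      (x 8, x 9 ^ y);
      (x 1, x 14 ^ y);
      (x 10, x 11 ^ y)].

Definition G_K2 : groupType := presented K2_relations.

(* Main.v *)
(* Put a = x_2 and c_i = y^(a^i).  Eliminating generators presents G(K_2) as
   <a, y | a commutes with c_3 c_4 c_3^-1 c_2^-2 c_1^-1 c_0 c_1>, that is, as
   F ><| <a> with F free on c_0, ..., c_4; conjugation by a shifts the c_i, and
   c_5 is given by a recurrence.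

   G(K_2) is residually a finite 2-group.  In a finite 2-group U every sequence
   satisfying the recurrence has period a power of 2, because modulo 2 the
   linearised recurrence is unipotent: t^5 - t^4 - t - 1 = (t - 1)^5.  Such a
   sequence s therefore gives an action of G(K_2) on Z/2^L x U in which a shifts
   the first factor and c_i acts on {j} x U as right multiplication by s_(j+i); its
   image is a finite 2-group.  As s_0, ..., s_4 are arbitrary in U and free groups
   are residually finite 2-groups, every nontrivial element of F survives in such an
   image.  Hence the lower central series meets in 1 at its finite stages.

   It does not reach 1 after finitely many steps, since G(K_2) maps onto S_3 with
   a going to a transposition and y to a 3-cycle. *)

From mathcomp Require Import all_boot all_fingroup all_solvable.
From mathcomp Require Import boolp classical_sets.
Require Import Defs.

Set Implicit Arguments.
Unset Strict Implicit.
Unset Printing Implicit Defensive.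

Import GroupScope.
Local Open Scope group_scope.

(** * Group morphisms *)

Lemma gmorph1 (G H : groupType) (phi : G -> H) :
  {morph phi : g h / g * h} -> phi 1 = 1.
Proof. by move=> phiM; apply: (mulIg (phi 1)); rewrite -phiM !mul1g. Qed.

Lemma gmorphV (G H : groupType) (phi : G -> H) :
  {morph phi : g h / g * h} -> forall g, phi g^-1 = (phi g)^-1.
Proof.
by move=> phiM g; apply: (mulIg (phi g)); rewrite -phiM !mulVg (gmorph1 phiM).
Qed.

Lemma gmorphX (G H : groupType) (phi : G -> H) :
  {morph phi : g h / g * h} -> forall g n, phi (g ^+ n) = phi g ^+ n.
Proof.
by move=> phiM g; elim=> [|n IH]; [exact: gmorph1|rewrite !expgS phiM IH].
Qed.

Lemma gmorphJ (G H : groupType) (phi : G -> H) :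
  {morph phi : g h / g * h} -> forall g h, phi (g ^ h) = phi g ^ phi h.
Proof. by move=> phiM g h; rewrite !conjgE !phiM gmorphV. Qed.

(** * A two-generator presentation *)

Ltac group_norm :=
  rewrite ?(mulg1, mul1g, invg1, invgK, invgM, mulgA, mulgK, mulgVK, mulgV, mulVg).

Definition K2_fixed (H : groupType) (a y : H) : H :=
  let c i := y ^ (a ^+ i) in
  c 3 * c 4 * (c 3)^-1 * (c 2)^-1 * (c 2)^-1 * (c 1%N)^-1 * c 0%N * c 1%N.

(* What remains of the relations once every generator is expressed by [x_2] and [y]:
   [x_2] commutes with this element. *)
Definition K2_comm (H : groupType) (a y : H) : H :=
  y * a ^ (y^-1 * a) * y^-1 * y^-1 * a * y^-1 * a * y * a^-1 * y.

(** Collect the powers of [a] on the right: a letter [y] preceded by total exponent k of [a] becomes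
    [y ^ (a ^- k)], and here k runs from -1 to 3. *)
Lemma K2_commE (H : groupType) (a y : H) :
  K2_comm a y = K2_fixed a y ^ (a ^- 3) * a ^+ 2.
Proof.
rewrite /K2_comm /K2_fixed !(expgS, expg0, conjgE) /=.
by group_norm.
Qed.

Lemma K2_comm_fixed (H : groupType) (a y : H) :
  commute a (K2_comm a y) <-> commute a (K2_fixed a y).
Proof.
have fixX u n : commute a u -> u ^ (a ^+ n) = u.
  by move=> au; apply/conjg_fixP/commgP/commuteX/commute_sym.
have a2 : commute a (a ^+ 2) by exact: commuteX.
rewrite K2_commE; set v := K2_fixed a y; split=> av.
  suff av3 : commute a (v ^ a ^- 3).
    by rewrite -[v](conjgKV (a ^+ 3)) (fixX _ _ av3).
  by rewrite -[v ^ _](mulgK (a ^+ 2)); apply: commuteM av _; exact: commuteV.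
by apply: commuteM a2; rewrite -(fixX v 3) // conjgK.
Qed.

(** Both sides of the equation are conjugates of [a], and [K2_comm a y] is the quotient of the two
    conjugating words. *)
Lemma K2_comm_rel (H : groupType) (a y : H) : commute a (K2_comm a y) <->
  a ^ (y^-1 * a) = ((a ^ (y * a ^ (y^-1 * a) * y^-1)) ^ (y^-1 * a)) ^ (a ^ y).
Proof.
have E : (a ^ (y^-1 * a) =
          ((a ^ (y * a ^ (y^-1 * a) * y^-1)) ^ (y^-1 * a)) ^ (a ^ y)) <->
         a ^ (K2_comm a y) = a.
  rewrite -!conjgM; split=> e.
    apply: (@conjg_inj _ (y^-1 * a)); rewrite e -conjgM; congr (_ ^ _).
    by rewrite /K2_comm !conjgE; group_norm.
  rewrite -{1}e -conjgM; congr (_ ^ _).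
  by rewrite /K2_comm !conjgE; group_norm.
by rewrite E; split=> [/commgP/conjg_fixP|/conjg_fixP/commgP].
Qed.

(* In the order y, x_1, ..., x_14. *)
Definition K2_arcs (H : groupType) (a y b c d : H) : seq H :=
  [:: y; a ^ y; a; a ^ y; (a ^ y) ^ y; a ^ y; c ^ y; c; d ^ y; d; b; b ^ y^-1; b;
      a ^ y^-1; a].

Local Notation K2_cl := (pres_class K2_relations).

(** With [b], [c], [d] as the values of x_12, x_7, x_9, every relation holds by construction except
    x_9 x_1 = x_1 x_10, which is the hypothesis in disguise. *)
Lemma K2_lift (H : groupType) (a y : H) : commute a (K2_fixed a y) ->
  exists phi : G_K2 -> H,
    [/\ {morph phi : g h / g * h}, phi (K2_cl (K2_x 2)) = a & phi (K2_cl K2_y) = y].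
Proof.
move=> ay; have := proj1 (K2_comm_rel a y) (proj2 (K2_comm_fixed a y) ay).
move bE : (a ^ (y^-1 * a)) => b; move cE : (a ^ (y * b * y^-1)) => c.
move dE : (c ^ (y^-1 * a)) => d r.
have [|phi phiM phiE] :=
    @presented_lift _ K2_relations H (fun i => nth 1 (K2_arcs a y b c d) i).
  move=> u v; rewrite /K2_relations !inE /=.
  do !case/orP; move=> /eqP[-> ->] /=; rewrite !inordK //= -?conjgE ?conjgKV //.
  - by rewrite -cE conjgC -!conjgM mulgVK.
  - by rewrite -bE conjgM -conjgC.
  - by rewrite -dE conjgC -conjgM !conjgE; group_norm.
  - by rewrite r conjgC.
by exists phi; split; rewrite ?phiE ?inordK.
Qed.

(** Tietze elimination inside [G_K2]: the conjugation relations and three crossings express all arcs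
    through [a] and [y]; the crossing x_9 x_1 = x_1 x_10 leaves the last equation. *)
Lemma K2_arcE (a := K2_cl (K2_x 2)) (y := K2_cl K2_y) (b := a ^ (y^-1 * a))
    (c := a ^ (y * b * y^-1)) (d := c ^ (y^-1 * a)) :
  (forall i : 'I_15, K2_cl (Gen i) = nth 1 (K2_arcs a y b c d) i) /\
  b = d ^ (a ^ y).
Proof.
have rel u v : (u, v) \in K2_relations ->
    word_eval (fun i => K2_cl (Gen i)) u = word_eval (fun i => K2_cl (Gen i)) v.
  by move=> uv; rewrite -!pres_class_eval; exact: presented_rel.
pose X i : G_K2 := K2_cl (K2_x i).
have mul i j k l : (K2_x i * K2_x j, K2_x k * K2_x l) \in K2_relations ->
    X i * X j = X k * X l by exact: rel.
have r1 : X 5 * X 12 = X 12 * X 6 by apply: mul; rewrite !inE eqxx.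
have r2 : a * X 12 = X 13 * a by apply: mul; rewrite !inE eqxx ?orbT.
have r3 : X 7 * X 3 = X 3 * X 8 by apply: mul; rewrite !inE eqxx ?orbT.
have r4 : X 9 * X 1%N = X 1%N * X 10 by apply: mul; rewrite !inE eqxx ?orbT.
have conj i j : (K2_x i, K2_x j ^ K2_y) \in K2_relations -> X i = X j ^ y by exact: rel.
have e3 : X 3 = a ^ y by apply: conj; rewrite !inE eqxx ?orbT.
have e6 : X 6 = X 7 ^ y by apply: conj; rewrite !inE eqxx ?orbT.
have e12 : X 12 = X 11 ^ y by apply: conj; rewrite !inE eqxx ?orbT.
have e4 : X 4 = X 5 ^ y by apply: conj; rewrite !inE eqxx ?orbT.
have e14 : X 14 = X 13 ^ y by apply: conj; rewrite !inE eqxx ?orbT.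
have e1 : X 1%N = a ^ y by apply: conj; rewrite !inE eqxx ?orbT.
have e4' : X 4 = X 3 ^ y by apply: conj; rewrite !inE eqxx ?orbT.
have e8 : X 8 = X 9 ^ y by apply: conj; rewrite !inE eqxx ?orbT.
have e1' : X 1%N = X 14 ^ y by apply: conj; rewrite !inE eqxx ?orbT.
have e10 : X 10 = X 11 ^ y by apply: conj; rewrite !inE eqxx ?orbT.
have e5 : X 5 = a ^ y by apply: (@conjg_inj _ y); rewrite -e4 e4' e3.
have e14a : X 14 = a by apply: (@conjg_inj _ y); rewrite -e1' e1.
have e13 : X 13 = a ^ y^-1 by rewrite -e14a e14 conjgK.
have e12b : X 12 = b by rewrite /b conjgM -e13 conjgE -r2 mulKg.
have e11 : X 11 = b ^ y^-1 by rewrite -e12b e12 conjgK.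
have e10b : X 10 = b by rewrite e10 -e12.
have e6c : X 6 = c ^ y.
  by rewrite /c -conjgM mulgVK conjgM -e5 -e12b conjgE r1 mulKg.
have e7 : X 7 = c by apply: (@conjg_inj _ y); rewrite -e6.
have e8d : X 8 = d ^ y.
  rewrite -[X 8](mulKg (X 3)) -r3 e7 e3 -conjgE -!conjgM; congr (_ ^ _).
  by rewrite conjgE; group_norm.
have e9 : X 9 = d by apply: (@conjg_inj _ y); rewrite -e8.
split; last by rewrite -e9 -e10b -e1 conjgE r4 mulKg.
have e0 : X 0%N = y by congr (K2_cl (Gen _)); apply: val_inj; rewrite /= inordK.
have e4a : X 4 = (a ^ y) ^ y by rewrite e4' e3.
move=> i; rewrite -[i]inord_val; case: i => i /= lti; rewrite inordK //.
by move: lti; do 15?[case: i => [|i] //=].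
Qed.

Lemma K2_rel_fixed : commute (K2_cl (K2_x 2)) (K2_fixed (K2_cl (K2_x 2)) (K2_cl K2_y)).
Proof.
by rewrite -K2_comm_fixed K2_comm_rel; exact: (proj2 K2_arcE).
Qed.

Lemma K2_ind (P : G_K2 -> Prop) :
    P 1 -> (forall g h, P g -> P h -> P (g * h)) -> (forall g, P g -> P g^-1) ->
    P (K2_cl (K2_x 2)) -> P (K2_cl K2_y) ->
  forall g, P g.
Proof.
move=> P1 PM PV Pa Py.
have PJ g h : P g -> P h -> P (g ^ h) by move=> Pg Ph; apply: (PM); [exact: PV|exact: PM].
move=> g; rewrite -(pres_repr g) pres_class_eval.
elim: (generic_quotient.repr g) => //= [i|u Pu|u Pu v Pv]; [|exact: PV|exact: PM].
rewrite (proj1 K2_arcE) /=; case: i => i /= _.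
by do 15?[case: i => [|i] /=]; rewrite ?nth_nil; auto 20.
Qed.

(** * Transfinite lower central series *)

Section TransfiniteLCS.
Local Open Scope classical_set_scope.
Local Open Scope group_scope.

Definition normal_subgroup (G : groupType) (A : set G) :=
  group_closed [in A] /\ forall g h, A g -> A (g ^ h).

Lemma group_closed_set (G : groupType) (A : set G) :
  group_closed [in A] <-> A 1 /\ forall g h, A g -> A h -> A (g * h^-1).
Proof.
split=> -[A1 AF]; split=> [|g h Ag Ah]; apply/asboolP => //; apply: AF; exact/asboolP.
Qed.

Lemma comm_gen_group (G : groupType) (A : set G) : group_closed [in comm_gen A].
Proof.
apply/group_closed_set; split=> [H [/group_closed_set[H1 _] _] //|g h gA hA].
by move=> H HA; case: (HA) => /group_closed_set[_ HF] _; apply: HF; [exact: gA|exact: hA].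
Qed.

Lemma comm_gen_comm (G : groupType) (A : set G) a g : A a -> comm_gen A [~ a, g].
Proof. by move=> Aa H [_]; apply; exists a => //; exists g. Qed.

Lemma comm_gen_min (G : groupType) (A B : set G) : group_closed [in B] ->
  (forall a g, A a -> B [~ a, g]) -> comm_gen A `<=` B.
Proof. by move=> Bg AB x; apply; split=> // _ [a Aa [g _ <-]]; exact: AB. Qed.

Lemma comm_gen_normal (G : groupType) (A : set G) :
  normal_subgroup A -> normal_subgroup (comm_gen A).
Proof.
move=> [_ AJ]; split=> [|g h]; first exact: comm_gen_group.
have [c1 cF] := proj1 (group_closed_set _) (comm_gen_group A).
move: g; apply: comm_gen_min => [|a g Aa /=].
  apply/group_closed_set; split=> [|x y] /=; first by rewrite conj1g.
  by rewrite conjMg conjVg; exact: cF.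
by rewrite conjRg; apply: comm_gen_comm; exact: AJ.
Qed.

Lemma comm_gen_sub (G : groupType) (A : set G) : normal_subgroup A -> comm_gen A `<=` A.
Proof.
move=> [Ag AJ]; apply: comm_gen_min => // a g Aa; move: Ag => /group_closed_set[A1 AF].
have AV x : A x -> A x^-1 by move=> Ax; rewrite -[_^-1]mul1g; exact: AF.
by rewrite commgEl -[_ ^ _]invgK; apply: AF; apply: AV => //; exact: AJ.
Qed.

Lemma lcs_at_normal (G : groupType) (a : ordnum) (w : a) : normal_subgroup (lcs_at G w).
Proof.
elim: (ord_lt_wf w) => {}w _ IH; rewrite lcs_atE.
have IHs v (vw : v ≺ w) := proj1 (group_closed_set _) (proj1 (IH v vw)).
have IHc v (vw : v ≺ w) := comm_gen_normal (IH v vw).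
have IHcs v (vw : v ≺ w) := proj1 (group_closed_set _) (proj1 (IHc v vw)).
split; [apply/group_closed_set; split|].
- by split=> [v vw _ _|_ v vw]; [exact: (proj1 (IHcs v vw))|exact: (proj1 (IHs v vw))].
- move=> g h [g1 g2] [h1 h2]; split=> [v vw c v0|l v vw].
    by apply: (proj2 (IHcs v vw)); [exact: g1|exact: h1].
  by apply: (proj2 (IHs v vw)); [exact: g2|exact: h2].
- move=> g h [g1 g2]; split=> [v vw c v0|l v vw].
    by apply: (proj2 (IHc v vw)); exact: g1.
  by apply: (proj2 (IH v vw)); exact: g2.
Qed.

Lemma lcs_at0 (G : groupType) (a : ordnum) (w : a) : ord_is0 w -> lcs_at G w = setT.
Proof.
by move=> w0; rewrite lcs_atE; apply/seteqP; split=> // g _; split=> [v /w0|[]].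
Qed.

Lemma lcs_at_anti (G : groupType) (a : ordnum) (v w : a) : v ≺ w ->
  lcs_at G w `<=` lcs_at G v.
Proof.
elim: (ord_lt_wf w) v => {}w _ IH v vw g; rewrite {1}lcs_atE => -[gc gl].
have [l|] := pselect (ord_limit w); first exact: gl.
(* Since [v] lies below [w], a non-limit [w] has an immediate predecessor [u]. *)
case/not_andP => [/contrapT /(_ v) //|/existsNP[u /contrapT uw]].
have {gc} gu : lcs_at G u g.
  have [u0|u0] := pselect (ord_is0 u); first by rewrite lcs_at0.
  by apply: comm_gen_sub; [exact: lcs_at_normal|exact: gc (proj1 uw) uw u0].
by case: (proj2 uw v vw) => [->//|vu]; exact: IH (proj1 uw) _ vu _ gu.
Qed.

Lemma lcs_initial (G : groupType) (a b : ordnum) (f : b -> a) (m : a) : ord_mono f ->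
  (forall z, z ≺ m <-> range f z) -> lcs_at G (Some m : ord_succ a) = lcs G b.
Proof.
move=> fm fr; pose h (y : ord_succ b) : ord_succ a :=
  Some (if y is Some y then f y else m).
have fm' y : f y ≺ m by apply/fr; exists y.
rewrite -[Some m]/(h None); apply: (@lcs_at_initial _ (ord_succ b)).
  by move=> [y|] [z|] //= yz; exact: fm.
move=> y [z|] //= zy.
have /fr[t _ <-] : z ≺ m.
  by case: y zy => //= y zy; exact: ord_lt_trans zy (fm' y).
by exists (Some t).
Qed.

Lemma lcs_anti (G : groupType) (a b : ordnum) : ordnum_lt b a -> lcs G a `<=` lcs G b.
Proof.
by move=> [f [m [fm fr]]]; rewrite -(lcs_initial G fm fr); exact: lcs_at_anti.
Qed.

Lemma lcs_iso (G : groupType) (a b : ordnum) (f : a -> b) : ord_mono f ->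
  (forall z, range f z) -> lcs G a = lcs G b.
Proof.
move=> fm fr; pose h (y : ord_succ a) : ord_succ b := omap f y.
rewrite /lcs -[None in RHS]/(h None); apply/esym/lcs_at_initial.
  by move=> [y|] [z|] //=; exact: fm.
move=> y [z|] /=; last by exists None.
by have [t _ <-] := fr z; exists (Some t).
Qed.

(** The series starts at index 1 and [lcs_succ] asks for an inhabited index, hence the shift. *)
Lemma lcs_fin (G : groupType) n :
  lcs G (ord_fin n.+2) = comm_gen (lcs G (ord_fin n.+1)).
Proof.
rewrite -(lcs_succ G (ord0 : ord_fin n.+1)).
pose f (y : ord_succ (ord_fin n.+1)) : ord_fin n.+2 :=
  if y is Some i then widen_ord (leqnSn _) i else ord_max.
apply/esym/(@lcs_iso _ _ _ f).
  by move=> [i|] [j|] // _; exact: (ltn_ord (i : 'I__)).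
move=> i; have [lti|lei] := ltnP i n.+1.
  by exists (Some (Ordinal lti)) => //; exact: val_inj.
exists None => //; apply: val_inj => /=; apply/eqP.
by rewrite eqn_leq lei -ltnS ltn_ord.
Qed.

Lemma fin_lt_omega2 (a : ordnum) n :
  ordnum_lt (ord_mul ord_omega ord_omega) a -> ordnum_lt (ord_fin n) a.
Proof.
(* A finite ordinal is the bottom of the first copy of omega, which [f] carries into [a]. *)
move=> [f [m [fm fr]]]; exists (fun i => f (nat_of_ord i, 0%N)), (f (n, 0%N)).
split=> [i j ij|z]; first by apply: fm; right.
split=> [zn|[i _ <-]]; last by apply: fm; right; split=> //; exact: ltn_ord.
have [[i j] _ fij] : range f z.
  by apply/fr/(ord_lt_trans zn)/fr; exists (n, 0%N).
move: zn; rewrite -fij => /(initial_lt fm) [//|[/= -> lti]].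
by exists (Ordinal lti).
Qed.

(** If the terms [n.+1] and [n.+2] agreed, the finite terms would be constant from there on and [g0]
    would lie in all of them. For the upper bound, a term of infinite index lies in all finite
    terms, so it is already trivial. *)
Lemma lcs_length_of_residual (G : groupType) (g0 : G) n :
    (forall g, (forall k, lcs G (ord_fin k.+1) g) -> g = 1) ->
    lcs G (ord_fin n.+1) g0 -> g0 <> 1 ->
  lcs_length_ge G (ord_fin n.+1) /\
  lcs_length_le G (ord_mul ord_omega ord_omega).
Proof.
move=> Gres Gg0 g01; split.
  exists (ord_fin n.+1); first by exists id => // x z _; exists z.
  rewrite (lcs_succ _ (ord0 : ord_fin n.+1)) => e.
  apply/g01/Gres => k.
  have [kn|nk] := leqP k n.
    move: Gg0; rewrite leq_eqVlt in kn; case/orP: kn => [/eqP -> //|kn].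
    apply: lcs_anti.
    exists (fun i => widen_ord (leqW kn) i),
      (Ordinal (kn : (k.+1 < n.+1)%N) : ord_fin n.+1).
    split=> [//|z]; split=> [zk|[i _ <-]]; last exact: (ltn_ord (i : 'I__)).
    by exists (Ordinal zk) => //; exact: val_inj.
  have -> // : lcs G (ord_fin k.+1) = lcs G (ord_fin n.+1).
  elim: k nk => // k IH; rewrite ltnS leq_eqVlt => /orP[/eqP <-|/IH kE].
    by rewrite lcs_fin -e.
  by rewrite lcs_fin kE -e.
move=> a al.
have trivE b : (forall k, ordnum_lt (ord_fin k) b) -> lcs G b = [set 1].
  move=> kb; apply/seteqP; split=> g; last first.
    by move=> ->; exact: (proj1 (proj1 (group_closed_set _) (proj1 (lcs_at_normal _ _)))).
  by move=> bg; apply: Gres => k; exact: lcs_anti (kb _) _ bg.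
rewrite !trivE // => k; last exact: fin_lt_omega2.
have [f [m [fm fr]]] := fin_lt_omega2 k al.
exists (fun i => Some (f i)), (Some m); split=> //= -[z|] /=; last by split=> [[]|[]].
split=> [/fr[i _ <-]|[i _ [<-]]]; first by exists i.
by apply/fr; exists i.
Qed.

End TransfiniteLCS.

(** * Sequences satisfying the recurrence in a 2-group *)

Lemma pgroup_exponent (p : nat) (gT : finGroupType) (G : {group gT}) n :
  prime p -> {in G, forall x, x ^+ (p ^ n) = 1} -> p.-group G.
Proof.
move=> p_pr Gn; rewrite /pgroup; apply/pnatP; first exact: cardG_gt0.
move=> q q_pr qG; have [x Gx oq] := Cauchy q_pr qG.
have : (q %| p ^ n)%N by rewrite -oq order_dvdn Gn.
by rewrite Euclid_dvdX // => /andP[qp _]; rewrite inE /= -(dvdn_prime2 q_pr p_pr).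
Qed.

(** The morphism carries each finite term into the corresponding term for [H], and the latter series
    reaches 1 after [n] steps. *)
Lemma lcs_nilpotent_image (G : groupType) (gT : finGroupType) (H : {group gT})
    (phi : G -> gT) : {morph phi : g h / g * h} -> (forall g, phi g \in H) ->
    nilpotent H ->
  exists n, forall g, lcs G (ord_fin n.+1) g -> phi g = 1.
Proof.
move=> phiM phiH /lcnP[n Hn]; exists n => g.
have phi1 := gmorph1 phiM; have phiV := gmorphV phiM.
suff L k h : lcs G (ord_fin k.+1) h -> phi h \in 'L_k.+1(H).
  by move=> /L; rewrite Hn => /set1P.
elim: k h => [h _|k IH h]; first by rewrite lcn1.
rewrite lcs_fin; move: h; apply: comm_gen_min.
  apply/group_closed_set; split=> [|x y]; first by rewrite phi1 group1.
  by rewrite phiM phiV => Lx Ly; rewrite groupM ?groupV.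
move=> a h /IH aL; rewrite !phiM !phiV lcnSn.
by rewrite -conjgE -commgEl mem_commg.
Qed.

(** The word of [K2_fixed] along a sequence. The recurrence is [twist s n.+1 = twist s n]; it
    determines [s (n + 5)] from the five preceding values. *)
Definition twist (H : groupType) (s : nat -> H) n :=
  s (n + 3) * s (n + 4) * (s (n + 3))^-1 * (s (n + 2))^-1 * (s (n + 2))^-1 *
  (s (n + 1)%N)^-1 * s n * s (n + 1)%N.

Lemma K2_fixed_twist (H : groupType) (a y : H) :
  K2_fixed a y = twist (fun i => y ^ (a ^+ i)) 0.
Proof. by []. Qed.

Lemma twist_morph (gT rT : finGroupType) (D : {group gT}) (f : {morphism D >-> rT})
    (s : nat -> gT) n : (forall i, s i \in D) ->
  f (twist s n) = twist (f \o s) n.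
Proof.
move=> sD; rewrite /twist /=.
by rewrite !morphM ?morphV ?groupM ?groupV.
Qed.

Lemma twist_central (H : groupType) (s z : nat -> H) n :
    (forall i j, commute (s i) (z j)) ->
  twist (fun i => s i * z i) n = twist s n * twist z n.
Proof.
move=> sz; rewrite /twist.
have szV i j : commute (s i) (z j)^-1 by exact: commuteV.
have sVz i j : commute (s i)^-1 (z j) by exact/commute_sym/commuteV/commute_sym.
have sVzV i j : commute (s i)^-1 (z j)^-1 by exact: commuteV.
(* Interchange law; seven uses of it separate the eight factors from [s] from those from [z]. *)
have mulC x y u v : commute u y -> (x * y) * (u * v) = (x * u) * (y * v) :> H.
  by move=> yu; rewrite -!mulgA; congr (_ * _); rewrite !mulgA yu.
have invC i : (s i * z i)^-1 = (s i)^-1 * (z i)^-1.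
  by rewrite invgM; exact/esym/sVzV.
rewrite !invC.
do 7!(rewrite -[RHS]mulC; [congr (_ * _)|by do ?apply: commuteM]).
Qed.

(** In a commutative setting of exponent 2 the inner factors cancel and [twist z n] is
    [z (n + 4) * z n]; compare the values at [n] and [n + 4]. *)
Lemma twist_period8 (H : groupType) (z : nat -> H) : (forall i j, commute (z i) (z j)) ->
    (forall i, z i * z i = 1) -> (forall n, twist z n.+1 = twist z n) ->
  forall n, z (n + 8) = z n.
Proof.
move=> zC z2 zR n.
have zV i : (z i)^-1 = z i by apply: (mulIg (z i)); rewrite mulVg z2.
have zE i : twist z i = z (i + 4) * z i.
  have zK x j : x * z j * z j = x by rewrite -mulgA z2 mulg1.
  rewrite /twist !zV zK (zC (i + 3)%N (i + 4)%N) zK -!mulgA.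
  by rewrite (mulgA (z (i + 1)%N)) (zC (i + 1)%N i) -mulgA z2 mulg1.
have zT i : twist z (n + i) = twist z n.
  by elim: i => [|i <-]; rewrite ?addn0 ?addnS.
have := zT 4; rewrite !zE -addnA [z (n + 4) * _]zC.
by move/mulIg.
Qed.

Lemma twist_shift (H : groupType) (s : nat -> H) m n :
  twist (fun i => s (i + m)) n = twist s (n + m).
Proof. by rewrite /twist ![(n + m + _)%N]addnAC. Qed.

Lemma iter_period (T : Type) (s : nat -> T) p : (forall n, s (n + p) = s n) ->
  forall m n, s (n + m * p) = s n.
Proof. by move=> sp; elim=> [|m IH] n; rewrite ?addn0 // mulSn addnA IH. Qed.

(* If [s] has period [Q] modulo a central subgroup of order 2, then
   [s (n + Q) = s n * zeta n], where [zeta] satisfies the recurrence in that subgroup. *)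
Lemma twist_period (gT : finGroupType) (G : {group gT}) : 2.-group G ->
  exists L, forall s : nat -> gT, (forall n, s n \in G) ->
    (forall n, twist s n.+1 = twist s n) -> forall n, s (n + 2 ^ L) = s n.
Proof.
have [m] := ubnP #|G|; elim: m gT G => // m IH gT G ltGm pG.
have [G1|ntG] := eqVneq (G : {set gT}) 1.
  by exists 0%N => s; rewrite G1 => s1 _ n; rewrite !(set1P (s1 _)).
have ntZ : 'Z(G) != 1 by rewrite center_nil_eq1 // (pgroup_nil pG).
have [_ dvZ _] := pgroup_pdiv (pgroupS (center_sub G) pG) ntZ.
have [z Zz oz] := Cauchy (isT : prime 2) dvZ.
have sZ : <[z]> \subset 'Z(G) by rewrite cycle_subG.
have nZ : <[z]> <| G := sub_center_normal sZ.
have [sZG nZG] := andP nZ.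
have [|L HL] := IH _ (G / <[z]>)%G _ (quotient_pgroup _ pG).
  apply: leq_trans (ltn_quotient _ sZG) _ => //.
  by rewrite -cardG_gt1 -orderE oz.
(* The quotient gives period [2 ^ L]. The factor 8 makes [Q] a period of [zeta] too, and doubling
   once more produces [zeta n * zeta (n + Q) = zeta n * zeta n = 1]. *)
pose Q := (2 ^ L.+3)%N; exists L.+4 => s sG sR.
have Ns j : s j \in 'N(<[z]>) := fintype.subsetP nZG _ (sG j).
have cosetQ n : coset <[z]> (s (n + Q)) = coset <[z]> (s n).
  have -> : Q = (8 * 2 ^ L)%N by rewrite /Q -(expnD 2 3 L).
  apply: (iter_period (s := coset <[z]> \o s)) => {}n.
  apply: HL => k; first by rewrite mem_quotient.
  by rewrite -!twist_morph ?sR.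
pose zeta i := (s i)^-1 * s (i + Q)%N.
have zetaZ i : zeta i \in <[z]>.
  by apply: coset_idr; rewrite ?groupM ?groupV // morphM ?morphV ?groupV //= cosetQ mulVg.
have zetaC i g : g \in G -> commute g (zeta i).
  have /centerP[_ +] := fintype.subsetP sZ _ (zetaZ i) => zC Gg; exact/commute_sym/zC.
have zetaG i : zeta i \in G by apply: (fintype.subsetP sZG).
have zeta2 i : zeta i * zeta i = 1.
  by have := expg_cardG (zetaZ i); rewrite -orderE oz.
have sQ : (fun i => s i * zeta i) = (fun i => s (i + Q)%N).
  by apply/funext => i; rewrite /zeta mulVKg.
have zetaR n : twist zeta n.+1 = twist zeta n.
  have tE k : twist s (k + Q) = twist s k * twist zeta k.
    by rewrite -twist_central ?sQ ?twist_shift // => i j; exact: zetaC.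
  by apply: (mulgI (twist s n)); rewrite -{1}sR -!tE addSn sR.
have zetaQ n : zeta (n + Q) = zeta n.
  have -> : Q = (2 ^ L * 8)%N by rewrite mulnC -(expnD 2 3 L).
  apply: iter_period => {}n.
  by apply: twist_period8 => // i j; exact: zetaC.
move=> n; have -> : (2 ^ L.+4 = Q + Q)%N by rewrite expnS mul2n -addnn.
have sE i : s (i + Q) = s i * zeta i by rewrite /zeta mulVKg.
by rewrite addnA !sE zetaQ -mulgA zeta2 mulg1.
Qed.

(** * The finite images *)

Section CyclicAction.
Variables (gT : finGroupType) (U : {group gT}) (p : nat) (s : nat -> gT).
Hypotheses (sU : forall n, s n \in U) (sR : forall n, twist s n.+1 = twist s n).
Hypothesis sp : forall n, s (n + p.+1) = s n.

Local Notation T := ('I_p.+1 * gT)%type.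

Lemma cyclic_pred_inj : injective (fun t : T => (ord_pred t.1, t.2)).
Proof.
apply: (can_inj (g := fun t : T => (ordS t.1, t.2))) => -[i x] /=.
by rewrite ord_predK.
Qed.

Lemma cyclic_mul_inj : injective (fun t : T => (t.1, t.2 * s t.1)).
Proof.
apply: (can_inj (g := fun t : T => (t.1, t.2 * (s t.1)^-1))) => -[i x] /=.
by rewrite mulgK.
Qed.

(** Permutations compose from left to right, so [A] has to lower the first coordinate for
    [Y ^ (A ^+ i)] to read [s] at [j + i] over [j]. *)
Let A := perm cyclic_pred_inj.
Let Y := perm cyclic_mul_inj.

Lemma s_mod n : s (n %% p.+1) = s n.
Proof. by rewrite {2}(divn_eq n p.+1) addnC iter_period. Qed.

Lemma iter_ordS m (j : 'I_p.+1) : iter m (@ordS _) j = (j + m) %% p.+1 :> nat.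
Proof.
elim: m => [|m IH] /=; first by rewrite addn0 modn_small.
by rewrite IH -addn1 modnDml addn1 addnS.
Qed.

Lemma AXE m j x : (A ^+ m) (iter m (@ordS _) j, x) = (j, x).
Proof.
elim: m j x => [|m IH] j x; first by rewrite perm1.
by rewrite expgS permM permE /= ordSK IH.
Qed.

Lemma AXVE m j x : (A ^- m) (j, x) = (iter m (@ordS _) j, x).
Proof. by apply: (canLR (permK _)); rewrite AXE. Qed.

Lemma conjAE i j x : (Y ^ (A ^+ i)) (j, x) = (j, x * s (j + i)).
Proof. by rewrite !permM AXVE [Y _]permE /= AXE iter_ordS s_mod. Qed.

Lemma permV_mul (f : {perm T}) j (w : gT) :
  (forall x, f (j, x) = (j, x * w)) -> forall x, f^-1 (j, x) = (j, x * w^-1).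
Proof. by move=> fE x; apply: (canLR (permK _)); rewrite fE mulgVK. Qed.

Lemma fixedAYE j x : K2_fixed A Y (j, x) = (j, x * twist s j).
Proof.
rewrite K2_fixed_twist; set c := fun i => _.
have cE i x' : c i (j, x') = (j, x' * s (j + i)) by exact: conjAE.
clearbody c.
have cV i := permV_mul (cE i).
by rewrite /twist !permM !(cE, cV) addn0 !mulgA.
Qed.

(** [K2_fixed A Y] multiplies the fibre over [j] by [twist s j], which the recurrence makes
    independent of [j]. *)
Lemma commuteAY : commute A (K2_fixed A Y).
Proof.
have sC n : twist s n = twist s 0 by elim: n => // n <-; exact: sR.
apply/permP => -[j x]; rewrite [LHS]permM [RHS]permM fixedAYE ![A _]permE.
by rewrite fixedAYE /= !sC.
Qed.

(* The elements of the wreath product of [U] by a cyclic group of order [p.+1]. *)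
Definition shift_mul (f : {perm T}) := exists m (c : 'I_p.+1 -> gT),
  (forall j, c j \in U) /\ forall j x, f (j, x) = (iter m (@ordS _) j, x * c j).

Lemma shift_mul_group_set : group_set [set f | `[< shift_mul f >]].
Proof.
apply/group_setP; split=> [|f g]; rewrite !finset.in_set.
  by apply/asboolP; exists 0%N, (fun=> 1); split=> // j x; rewrite perm1 mulg1.
move=> /asboolP[m [c [cU fE]]] /asboolP[n [d [dU gE]]]; apply/asboolP.
exists (n + m)%N, (fun j => c j * d (iter m (@ordS _) j)); split=> [j|j x].
  exact: groupM.
by rewrite permM fE gE iterD mulgA.
Qed.

Canonical shift_mul_group := Group shift_mul_group_set.

(** The power [p.+1] undoes the shift and leaves on each fibre a right multiplication by an element
    of [U], which the power [#|U|] kills. *)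
Lemma shift_mul_exp (f : {perm T}) : shift_mul f -> f ^+ (p.+1 * #|U|) = 1.
Proof.
move=> fS.
have expS (g : {perm T}) n : shift_mul g -> shift_mul (g ^+ n).
  move=> gS; suff: g ^+ n \in shift_mul_group by rewrite finset.in_set => /asboolP.
  by apply: groupX; rewrite finset.in_set; apply/asboolP.
have [m [c [cU fE]]] := fS.
have iterE n j x :
    exists2 w, w \in U & (f ^+ n) (j, x) = (iter (n * m) (@ordS _) j, x * w).
  elim: n => [|n [w wU IH]]; first by exists 1; rewrite // perm1 mulg1.
  exists (w * c (iter (n * m) (@ordS _) j)); first exact: groupM.
  by rewrite expgSr permM IH fE mulSn iterD mulgA.
rewrite expgnA; apply/permP => -[j x]; rewrite perm1.
have [n [d [dU gE]]] := expS _ p.+1 fS.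
have {}gE x' : (f ^+ p.+1) (j, x') = (j, x' * d j).
  have [w _] := iterE p.+1 j x'; rewrite gE => -[+ _].
  rewrite -gE => jE; rewrite gE; congr (_, _).
  rewrite jE; apply: val_inj; rewrite /= iter_ordS.
  by rewrite addnC mulnC modnMDl modn_small.
suff -> k : (f ^+ p.+1 ^+ k) (j, x) = (j, x * d j ^+ k).
  by rewrite expg_cardG // mulg1.
by elim: k => [|k IH]; rewrite ?perm1 ?mulg1 // expgSr permM IH gE expgSr mulgA.
Qed.

End CyclicAction.

Lemma word_eval_morph (X : Type) (G H : groupType) (phi : G -> H) (f : X -> G) u :
  {morph phi : g h / g * h} -> phi (word_eval f u) = word_eval (phi \o f) u.
Proof.
move=> phiM; elim: u => //= [|u <-|u <- v <-]; [exact: gmorph1|exact: gmorphV|].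
by rewrite phiM.
Qed.

Definition fibre_gen (i : nat) : G_K2 := K2_cl K2_y ^ (K2_cl (K2_x 2) ^+ i).

(** A word in the [fibre_gen i] acts on the fibre over 0 as right multiplication by its value at
    [s], so it can die in the finite image only if that value is 1. *)
Lemma K2_word_image (gT : finGroupType) (U : {group gT}) (s : nat -> gT) :
    2.-group U -> (forall n, s n \in U) -> (forall n, twist s n.+1 = twist s n) ->
  exists n, forall u : word nat,
    lcs G_K2 (ord_fin n.+1) (word_eval fibre_gen u) -> word_eval s u = 1.
Proof.
move=> pU sU sR; have [L /(_ s sU sR) sp] := twist_period pU.
case pE : (2 ^ L)%N sp => [|p] sp; first by have := expn_gt0 2 L; rewrite pE.
have [phi [phiM phia phiy]] := K2_lift (commuteAY sR sp).
set A := perm _ in phia; set Y := perm _ in phiy.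
have AS : shift_mul U A.
  (* Lowering by one is the shift by [p] modulo [p.+1]. *)
  exists p, (fun=> 1); split=> // j x.
  rewrite permE mulg1; congr (_, _); apply: (can_inj (@ordSK _)).
  rewrite ord_predK -iterS; apply: ord_inj; rewrite iter_ordS modnDr.
  by rewrite modn_small.
have YS : shift_mul U Y.
  by exists 0%N, s; split=> // j x; rewrite permE.
have phiH g : phi g \in shift_mul_group U p.
  move: g; apply: K2_ind => [|g h|g||].
  - by rewrite gmorph1 ?group1.
  - by rewrite phiM; exact: groupM.
  - by rewrite gmorphV ?groupV.
  - by rewrite phia finset.in_set; apply/asboolP.
  - by rewrite phiy finset.in_set; apply/asboolP.
have nilH : nilpotent (shift_mul_group U p).
  have [M UE] := p_natP pU.
  apply: (@pgroup_nil _ 2); apply: (@pgroup_exponent _ _ _ (L + M)) => // f.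
  rewrite finset.in_set => /asboolP/shift_mul_exp <-.
  by rewrite expnD pE -UE.
have [n nE] := lcs_nilpotent_image phiM phiH nilH.
exists n => u /nE; rewrite (word_eval_morph _ _ phiM) => e.
suff uE v (j : 'I_p.+1) x :
    word_eval (phi \o fibre_gen) v (j, x) = (j, x * word_eval (fun i => s (j + i)) v).
  by have := uE u ord0 1; rewrite e perm1 mul1g => -[].
elim: v j x => /= [i||v IH|v IHv w IHw] j x.
- by rewrite /fibre_gen (gmorphJ phiM) (gmorphX phiM) phia phiy conjAE.
- by rewrite perm1 mulg1.
- exact: permV_mul.
- by rewrite permM IHv IHw mulgA.
Qed.

(** * Free products of involutions are residually 2-groups *)

Section Triangular.
Variable n : nat.
Local Notation T := {ffun 'I_n.+1 -> bool}.
Implicit Types (x y : T) (f g : {perm T}).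

Definition agree_below k x y := [forall i : 'I_n.+1, (i < k)%N ==> (x i == y i)].

Lemma agree_belowP k x y :
  reflect (forall i : 'I_n.+1, (i < k)%N -> x i = y i) (agree_below k x y).
Proof.
apply: (iffP forallP) => xy i; first by move/(implyP (xy i))/eqP.
by apply/implyP => ik; rewrite xy.
Qed.

(** Bit [i] changes by a function of the lower bits only. These permutations form a Sylow 2-subgroup
    of the symmetric group on the bit vectors. *)
Definition triangular f :=
  [forall x : T, forall y : T, forall i : 'I_n.+1,
     agree_below i x y ==> (f x i (+) x i == f y i (+) y i)].

Lemma triangularP f :
  reflect (forall x y (i : 'I_n.+1), (forall j : 'I_n.+1, (j < i)%N -> x j = y j) ->
             f x i (+) x i = f y i (+) y i)
          (triangular f).
Proof.
apply: (iffP forallP) => [fT x y i /agree_belowP xy|fT x].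
  by have /forallP/(_ y)/forallP/(_ i)/implyP/(_ xy)/eqP := fT x.
apply/forallP => y; apply/forallP => i; apply/implyP => /agree_belowP xy.
exact/eqP/fT.
Qed.

Lemma triangular_group_set : group_set [set f | triangular f].
Proof.
apply/group_setP; split=> [|f g]; rewrite !finset.in_set.
  by apply/triangularP => x y i _; rewrite !perm1 !addbb.
move=> /triangularP fT /triangularP gT; apply/triangularP => x y i xy.
have fE (j : 'I_n.+1) : (j <= i)%N -> f x j (+) x j = f y j (+) y j.
  by move=> ji; apply: fT => k kj; apply: xy; exact: leq_trans kj ji.
have fxy (j : 'I_n.+1) : (j < i)%N -> f x j = f y j.
  by move=> ji; have := fE j (ltnW ji); rewrite (xy _ ji) => /addIb.
rewrite !permM; move: (fE i (leqnn i)) (gT _ _ _ fxy).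
by case: (f x i) (f y i) (x i) (y i) (g _ i) (g _ i) => [] [] [] [] [] [].
Qed.

Canonical triangular_group := Group triangular_group_set.

(** Once the bits below [k] are fixed, bit [k] changes by a constant, so one squaring fixes it as
    well; [n.+1] squarings fix all bits. *)
Lemma triangular_pgroup : 2.-group triangular_group.
Proof.
apply: (@pgroup_exponent _ _ _ n.+1) => // f fT.
suff fix_below k x (i : 'I_n.+1) : (i < k)%N -> (f ^+ (2 ^ k)) x i = x i.
  by apply/permP => x; apply/ffunP => i; rewrite perm1 fix_below.
elim: k x i => // k IH x i; rewrite ltnS leq_eqVlt expnSr expgnA => ik.
have : f ^+ (2 ^ k) \in triangular_group by rewrite groupX.
move: (f ^+ _) IH => g IH; rewrite finset.in_set => /triangularP gT.
rewrite expg2 permM; case/orP: ik => [/eqP ik|ik]; last by rewrite !IH.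
have := gT (g x) x i; rewrite ik => /(_ (IH x)).
by case: (g x i) (x i) (g (g x) i) => [] [] [].
Qed.

End Triangular.

Section ChainInvolutions.
Variables (I : eqType) (i0 : I) (t : seq I).
Local Notation n := (size t).
Local Notation T := {ffun 'I_n.+1 -> bool}.
Hypothesis tR : forall j, (j.+1 < n)%N -> nth i0 t j != nth i0 t j.+1.

(** The letters of [t] label the edges of a path through the bits; the map of a letter is a product
    of transvections along the edges it labels. *)
Definition chain_fun (i : I) (x : T) : T :=
  [ffun j : 'I_n.+1 => x j (+) [&& (0 < j)%N, nth i0 t j.-1 == i & x (inord j.-1)]].

(** Consecutive letters differ, so a bit that is added to its successor is itself unchanged, and the
    second addition cancels the first. *)
Lemma chain_funK i : involutive (chain_fun i).
Proof.
move=> x; apply/ffunP => j; rewrite !ffunE.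
case: (posnP j) => [->|j0] /=; first by rewrite !addbF.
case: eqP => [ji|_] /=; last by rewrite !addbF.
have jn : (j.-1 < n)%N by rewrite prednK // -ltnS ltn_ord.
rewrite inordK; last exact: leqW.
have -> : [&& (0 < j.-1)%N, nth i0 t j.-1.-1 == i & x (inord j.-1.-1)] = false.
  case: posnP => //= j1; apply/negP => /andP[/eqP ji' _].
  by have := tR (j := j.-1.-1); rewrite prednK // ji ji' eqxx => /(_ jn).
by rewrite addbF -addbA addbb addbF.
Qed.

Definition chain i : {perm T} := perm (can_inj (chain_funK i)).

Lemma chain2 i : chain i * chain i = 1.
Proof. by apply/permP => x; rewrite permM !permE chain_funK. Qed.

Lemma chain_triangular i : chain i \in triangular_group n.
Proof.
rewrite finset.in_set; apply/triangularP => x y j xy; rewrite !permE !ffunE.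
rewrite [x j (+) _]addbC [y j (+) _]addbC !addbK.
case: posnP => //= j0; congr (_ && _); apply: xy.
have ltj : (j.-1 < j)%N by rewrite prednK.
by rewrite inordK //; exact: leq_trans ltj (ltnW (ltn_ord j)).
Qed.

(* The [m]-th factor moves the last nonzero coordinate from [m] to [m.+1]. *)
Lemma prod_chain_neq1 : (0 < n)%N -> \prod_(i <- t) chain i <> 1.
Proof.
move=> n0 t1; pose e : T := [ffun j => j == ord0].
(* Only the bits from [m] on are controlled. At the end the top bit has become 1, whereas it is 0 in
   [e]. *)
suff marked m : (m <= n)%N -> forall j : 'I_n.+1, (m <= j)%N ->
    (\prod_(i <- take m t) chain i) e j = (j == m :> nat).
  have := marked n (leqnn n) ord_max (leqnn n).
  by rewrite take_size t1 perm1 ffunE eqxx -val_eqE /= eqn0Ngt n0.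
elim: m => [_ j _|m IH mn j mj].
  by rewrite take0 big_nil perm1 ffunE -val_eqE.
rewrite (take_nth i0) // -cats1 big_cat big_seq1 permM [chain _ _]permE ffunE.
have j0 : (0 < j)%N by apply: leq_trans mj.
have j1 : (j.-1 < n.+1)%N by rewrite (leq_trans _ (ltnW (ltn_ord j))) // prednK.
have jE : (inord j.-1 : 'I_n.+1) = j.-1 :> nat by rewrite inordK.
have mj1 : (m <= j.-1)%N by rewrite -ltnS prednK.
rewrite !IH ?jE ?(ltnW mn) ?(ltnW mj) // j0 (gtn_eqF mj) /=.
rewrite -[in RHS](prednK j0) eqSS andbC.
by case: eqP => // ->; rewrite eqxx.
Qed.

End ChainInvolutions.

Lemma involutions_reduced (I : eqType) (t : seq I) : t != [::] ->
    sorted [rel i j | i != j] t ->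
  exists (gT : finGroupType) (U : {group gT}) (c : I -> gT),
    [/\ 2.-group U, forall i, c i \in U, forall i, c i * c i = 1 &
        \prod_(i <- t) c i <> 1].
Proof.
case: t => // i0 t _ tR.
have tR' j : (j.+1 < size (i0 :: t))%N -> nth i0 (i0 :: t) j != nth i0 (i0 :: t) j.+1.
  by move/(sortedP i0): tR; exact.
exists {perm {ffun 'I_(size (i0 :: t)).+1 -> bool}}, (triangular_group _), (chain tR').
split; [exact: triangular_pgroup|exact: chain_triangular|exact: chain2|].
exact: prod_chain_neq1.
Qed.

(** * Alternating words and their reduction *)

(* Number [i.+1] is the free generator [c_i]; number 0 is the identity, so that the
   alternating words of even length, products of [b_i^-1 b_j], fill the free group. *)
Definition base_word (i : 'I_6) : word nat := if i is Ordinal j.+1 _ then Gen j else 1.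

Fixpoint alt_word (b : bool) (t : seq 'I_6) : word nat :=
  if t is i :: t then (if b then base_word i else (base_word i)^-1) * alt_word (~~ b) t
  else 1.

(** Equal neighbours carry opposite signs in an alternating word, so they cancel there just as in a
    product of involutions. *)
Fixpoint reduce (t : seq 'I_6) : seq 'I_6 :=
  if t is i :: t then
    if reduce t is j :: t' then if i == j then t' else [:: i, j & t'] else [:: i]
  else [::].

Lemma reduce_sorted t : sorted [rel i j | i != j] (reduce t).
Proof.
elim: t => //= i t; case: (reduce t) => //= j t' t'R.
case: eqVneq => [ij|ij] /=; last by rewrite ij.
exact: path_sorted t'R.
Qed.

Lemma odd_reduce t : odd (size (reduce t)) = odd (size t).
Proof.
elim: t => //= i t; case: (reduce t) => [<-//|j t' /= <-].
by case: eqP; rewrite /= ?negbK.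
Qed.

Lemma eval_reduce (H : groupType) (f : nat -> H) b t :
  word_eval f (alt_word b (reduce t)) = word_eval f (alt_word b t).
Proof.
elim: t b => //= i t + b; move/(_ (~~ b)); case: (reduce t) => [|j t'] /= <- //.
case: eqP => [->|//]; rewrite negbK mulgA; case: b => /=.
  by rewrite mulgV mul1g.
by rewrite mulVg mul1g.
Qed.

(* The free group on the [c 0 * c i] sits in the free product of the groups
   generated by the involutions [c i]. *)
Lemma eval_involutions (H : groupType) (c : 'I_6 -> H) (f : nat -> H) b t :
    (forall i, c i * c i = 1) ->
    (forall i : 'I_6, word_eval f (base_word i) = c ord0 * c i) ->
  word_eval f (alt_word b t) =
  c ord0 ^+ b * \prod_(i <- t) c i * c ord0 ^+ (b (+) odd (size t)).
Proof.
move=> c2 fE; have cV i : (c i)^-1 = c i by apply: (mulIg (c i)); rewrite mulVg c2.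
elim: t b => [|i t IH] b /=.
  by rewrite big_nil mulg1 addbF; case: b; rewrite /= ?mulg1 ?c2.
rewrite big_cons IH addbN -addNb; case: b => /=.
  by rewrite fE !mulgA mulg1.
by rewrite fE invgM !cV mul1g !mulgA -[c i * _ * _]mulgA c2 mulg1.
Qed.

(** The state is a window of five consecutive values; the new entry is the recurrence solved for
    [s (n + 5)]. *)
Definition twist_next (H : groupType) (k : H * H * H * H * H) : H * H * H * H * H :=
  let: (k0, k1, k2, k3, k4) := k in
  (k1, k2, k3, k4, k4^-1 * (k3 * k4 * k3^-1 * k2^-1 * k2^-1 * k1^-1 * k0 * k1) *
                   k2^-1 * k1^-1 * k2 * k3 * k3 * k4).

Lemma twist_extend (gT : finGroupType) (U : {group gT}) (f : nat -> gT) :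
    (forall i, f i \in U) ->
  exists s, [/\ forall i, s i \in U, forall n, twist s n.+1 = twist s n &
                forall i, (i < 5)%N -> s i = f i].
Proof.
move=> fU; pose k n := iter n (@twist_next gT) (f 0, f 1, f 2, f 3, f 4)%N.
pose s n := (k n).1.1.1.1.
have kE n : k n = (s n, s (n + 1), s (n + 2), s (n + 3), s (n + 4))%N.
  rewrite /s !addnS !addn0 /k /=.
  by case: (iter n _ _) => [[[[k0 k1] k2] k3] k4].
have s5 n : s (n.+1 + 4)%N = (twist_next (k n)).2.
  by have /(congr1 snd) /= <- := kE n.+1.
have sR n : twist s n.+1 = twist s n.
  by rewrite [LHS]/twist s5 kE /= !addSnnS /twist -[in s n.+1]addn1; group_norm.
exists s; split=> // [i|i].
  suff: [&& (k i).1.1.1.1 \in U, (k i).1.1.1.2 \in U, (k i).1.1.2 \in U,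
            (k i).1.2 \in U & (k i).2 \in U] by case/and5P.
  elim: i => [|i]; first by rewrite /= !fU.
  rewrite /k /=; case: (iter _ _ _) => [[[[k0 k1] k2] k3] k4] /=.
  by case/and5P=> U0 U1 U2 U3 U4; rewrite !groupM ?groupV // U1 U2 U3 U4.
by do 5?[case: i => [|i] //].
Qed.

(** If the reduced word is not empty, some involutions [g i] in a 2-group have nontrivial product
    along it. The sequence starting with the [g ord0 * g i], for nonzero [i], and continued by the
    recurrence evaluates the word to that product, against [K2_word_image]. *)
Lemma K2_residual_word (t : seq 'I_6) : ~~ odd (size t) ->
    (forall n, lcs G_K2 (ord_fin n.+1) (word_eval fibre_gen (alt_word false t))) ->
  word_eval fibre_gen (alt_word false t) = 1.
Proof.
rewrite -odd_reduce -eval_reduce; have tR := reduce_sorted t.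
case: (eqVneq (reduce t) [::]) => [-> //|t0] te tL.
have [gT [U [g [pU gU g2 g1]]]] := involutions_reduced t0 tR.
have [s [sU sR sE]] := @twist_extend gT U (fun i => g ord0 * g (inord i.+1))
   (fun i => groupM (gU _) (gU _)).
have [n nE] := K2_word_image pU sU sR.
move: (tL n) => /nE.
rewrite (eval_involutions (c := g)) // => [|i].
  by rewrite (negPf te) mul1g mulg1 => /g1.
case: i => -[|i] ilt /=; first by rewrite (_ : Ordinal _ = ord0) ?g2 //; exact: val_inj.
rewrite sE //; congr (_ * g _); apply: val_inj; rewrite /= inordK //.
Qed.

(** * Residual nilpotency *)

Local Notation a := (K2_cl (K2_x 2) : G_K2).
Local Notation y := (K2_cl K2_y : G_K2).
Local Notation c := fibre_gen.

(** The subgroup generated by [c 0], ..., [c 4], in the form required by [K2_residual_word]. *)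
Definition fibre (g : G_K2) :=
  exists2 t : seq 'I_6, ~~ odd (size t) & g = word_eval c (alt_word false t).

Lemma word_eval_alt_cat (H : groupType) (f : nat -> H) b t1 t2 :
  word_eval f (alt_word b (t1 ++ t2)) =
  word_eval f (alt_word b t1) * word_eval f (alt_word (b (+) odd (size t1)) t2).
Proof.
elim: t1 b => [|i t1 IH] b /=; first by rewrite mul1g addbF.
by rewrite IH mulgA addNb addbN.
Qed.

Lemma fibreM g h : fibre g -> fibre h -> fibre (g * h).
Proof.
move=> [t1 t1e ->] [t2 t2e ->]; exists (t1 ++ t2).
  by rewrite size_cat oddD (negPf t1e).
by rewrite word_eval_alt_cat (negPf t1e).
Qed.

Lemma fibreV g : fibre g -> fibre g^-1.
Proof.
move=> [t te ->]; have [m] := ubnP (size t); elim: m t te => // m IH [|i [|j t]] //=.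
  by move=> _ _; exists [::]; rewrite //= invg1.
rewrite negbK mulgA invgM => te tm; apply: fibreM; first by apply: IH => //; apply: ltnW.
by exists [:: j; i]; rewrite //= mulg1 invgM invgK.
Qed.

Lemma fibre_c i : (i < 5)%N -> fibre (c i).
Proof.
move=> i5; exists [:: ord0; inord i.+1] => //=.
have -> : base_word (inord i.+1) = Gen i.
  have : (inord i.+1 : 'I_6) = i.+1 :> nat by rewrite inordK.
  by case: (inord _) => -[|k] klt //= [->].
by rewrite /= invg1 mulg1 mul1g.
Qed.

Lemma fibre_conj x : (forall i, (i < 5)%N -> fibre (c i ^ x)) ->
  forall g, fibre g -> fibre (g ^ x).
Proof.
move=> cx g [t _ ->]; have f1 : fibre 1 by exists [::].
move: t false; elim=> [|i t IH] b /=; first by rewrite conj1g.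
rewrite conjMg; apply: fibreM; last exact: IH.
suff: fibre (word_eval c (base_word i) ^ x).
  by case: b => //= /fibreV; rewrite conjVg.
case: i => -[|i] /= ilt; first by rewrite conj1g.
exact: cx.
Qed.

Lemma conj_twist (H : groupType) (s : nat -> H) n x :
  twist s n ^ x = twist (fun i => s i ^ x) n.
Proof. by rewrite /twist !conjMg !conjVg. Qed.

Lemma c_conj i : c i ^ a = c i.+1.
Proof. by rewrite /c -conjgM -expgSr. Qed.

Lemma twist_c_fix : twist c 0 ^ a = twist c 0.
Proof. by apply/conjg_fixP/commgP/commute_sym; exact: K2_rel_fixed. Qed.

Lemma fibre_twist : fibre (twist c 0).
Proof.
by rewrite /twist; do ![exact: fibre_c|apply: fibreM|apply: fibreV].
Qed.

Lemma twist_last (H : groupType) (s : nat -> H) : twist s 1 = twist s 0 ->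
  s 5 = (s 4)^-1 * twist s 0 * (s 2)^-1 * (s 1%N)^-1 * s 2 * s 3 * s 3 * s 4.
Proof. by move=> <-; rewrite /twist !add1n; group_norm. Qed.

Lemma twist_first (H : groupType) (s : nat -> H) :
  s 0%N = s 1%N * s 2 * s 2 * s 3 * (s 4)^-1 * (s 3)^-1 * twist s 0 * (s 1%N)^-1.
Proof. by rewrite /twist !add0n; group_norm. Qed.

(** Conjugation by [a] shifts the generators; only [c 5] leaves the list, and the recurrence brings
    it back. *)
Lemma fibre_conj_a g : fibre g -> fibre (g ^ a).
Proof.
apply: fibre_conj => i; rewrite c_conj ltnS leq_eqVlt.
case/orP=> [/eqP ->|i4]; last exact: fibre_c.
rewrite twist_last.
  by do ![exact: fibre_twist|exact: fibre_c|apply: fibreM|apply: fibreV].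
by rewrite -[RHS]twist_c_fix conj_twist /twist !c_conj.
Qed.

Lemma fibre_conj_aV g : fibre g -> fibre (g ^ a^-1).
Proof.
have cV i : c i.+1 ^ a^-1 = c i by rewrite -c_conj conjgK.
apply: fibre_conj => -[_|i i5]; last by rewrite cV; apply: fibre_c; exact: ltnW.
(* The recurrence is run backwards on the shifted sequence, whose [twist] is that of [c] because [a]
   fixes it. *)
rewrite (twist_first (fun i => c i ^ a^-1)) -conj_twist -{1}twist_c_fix conjgK.
rewrite !cV.
by do ![exact: fibre_twist|exact: fibre_c|apply: fibreM|apply: fibreV].
Qed.

(** Left multiplication by the generators and their inverses preserves this form, as [a] normalises
    the fibre. The two natural exponents encode one integer exponent. *)
Lemma fibre_decomp g : exists f m n, fibre f /\ g = f * a ^+ m * a ^- n.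
Proof.
pose S h := exists f m n, fibre f /\ h = f * a ^+ m * a ^- n.
have S1 : S 1.
  by exists 1, 0%N, 0%N; split; [exists [::]|rewrite expg0 invg1 !mulg1].
suff SM : forall h, S h -> S (g * h) /\ S (g^-1 * h).
  by rewrite -[g]mulg1; exact: (SM 1 S1).1.
apply: (@K2_ind (fun g => forall h, S h -> S (g * h) /\ S (g^-1 * h))) g.
- by move=> h Sh; rewrite invg1 mul1g.
- move=> g1 g2 H1 H2 h Sh; rewrite invgM -!mulgA; split.
    exact/(H1 _ _).1/(H2 _ _).1.
  exact/(H2 _ _).2/(H1 _ _).2.
- by move=> g H h /H[]; rewrite invgK.
- move=> h [f [m [n [ff ->]]]]; split.
    exists (f ^ a^-1), m.+1, n; split; first exact: fibre_conj_aV.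
    by rewrite expgS conjgE; group_norm.
  exists (f ^ a), m, n.+1; split; first exact: fibre_conj_a.
  rewrite expgSr invgM conjgE -!mulgA; congr (_ * (_ * _)).
  by rewrite [in RHS]mulgA (commuteX _ (commute_refl _)) -!mulgA mulKVg.
- move=> h [f [m [n [ff ->]]]].
  have fy : fibre y by rewrite -[y]conjg1; exact: (@fibre_c 0).
  rewrite !mulgA; split; [exists (y * f), m, n|exists (y^-1 * f), m, n];
    split=> //; apply: fibreM => //; exact: fibreV.
Qed.

Lemma fibre_of_lcs g : (forall k, lcs G_K2 (ord_fin k.+1) g) -> fibre g.
Proof.
move=> gL; have [f [m [n [ff gE]]]] := fibre_decomp g.
suff mn : m = n by rewrite gE mn mulgK.
(* A cycle of length [m + n + 1], which exceeds both exponents. Sending [a] to [s] and [y] to 1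
   kills the fibre and has abelian image. *)
pose s := perm (can_inj (@ordSK (m + n).+1)).
have s1 : commute s (K2_fixed s 1).
  have -> : K2_fixed s 1 = 1 by rewrite /K2_fixed !conj1g invg1 !mulg1.
  exact: commute1.
have [phi [phiM phia phiy]] := K2_lift s1.
have phi1 := gmorph1 phiM; have phiV := gmorphV phiM.
have phis h : phi h \in <[s]>.
  move: h; apply: K2_ind => [|x z xs zs|x xs||].
  - by rewrite phi1 group1.
  - by rewrite phiM groupM.
  - by rewrite phiV groupV.
  - by rewrite phia cycle_id.
  - by rewrite phiy group1.
have phif : phi f = 1.
  have [t _ ->] := ff; rewrite (word_eval_morph _ _ phiM).
  have w1 u : word_eval (phi \o c) u = 1.
    elim: u => //= [i|u ->|u -> v ->]; rewrite ?invg1 ?mulg1 //.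
    by rewrite /c conjgE !phiM !phiV phiy mul1g mulVg.
  exact: w1.
have [k] := lcs_nilpotent_image phiM phis (abelian_nil (cycle_abelian s)).
move=> /(_ g (gL k)); rewrite gE !phiM phif mul1g.
rewrite phiV !(gmorphX phiM) phia => /divg1_eq smn.
have sXE k' : (s ^+ k') ord0 = k' %% (m + n).+1 :> nat.
  have -> : (s ^+ k') ord0 = iter k' (@ordS _) ord0.
    by rewrite permX; elim: k' => //= k' ->; rewrite permE.
  by rewrite iter_ordS.
have := sXE m; rewrite smn sXE !modn_small // ltnS; [exact: leq_addr|exact: leq_addl].
Qed.

Lemma K2_residually_nilpotent g : (forall k, lcs G_K2 (ord_fin k.+1) g) -> g = 1.
Proof.
move=> gL; have [t te gE] := fibre_of_lcs gL.
by rewrite gE; apply: K2_residual_word => // n; rewrite -gE.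
Qed.

(** * A nontrivial iterated commutator *)

Lemma engel_mem_lcs (G : groupType) (x z : G) n :
  lcs G (ord_fin n.+1) (iter n (fun g => [~ g, x]) z).
Proof.
elim: n => [|n IH]; first by rewrite lcs1.
by rewrite lcs_fin iterS; exact: comm_gen_comm.
Qed.

(* [s] and [tperm i1 i2] generate S_3 and [s] inverts the 3-cycle [r], so taking
   commutators with [s] four times raises [r] to the power [(-2)^4]. *)
Lemma engel_K2_neq1 : iter 4 (fun g => [~ g, a]) y <> 1.
Proof.
pose i0 : 'I_3 := inord 0; pose i1 : 'I_3 := inord 1; pose i2 : 'I_3 := inord 2.
pose s := tperm i0 i1; pose r := s * tperm i1 i2.
have rs : r ^ s = r^-1 by rewrite conjgE -!mulgA mulKg invgM !tpermV.
(* The conjugates of [r] by powers of [s] alternate between [r] and its inverse, and the word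
   collapses to 1. *)
have sr : commute s (K2_fixed s r).
  have rX k : r ^ (s ^+ k.+2) = r ^ (s ^+ k).
    by rewrite !expgS mulgA tperm2 mul1g.
  rewrite /K2_fixed !rX expg0 expg1 conjg1 rs; group_norm; exact: commute1.
have [phi [phiM phia phiy]] := K2_lift sr.
have phi1 := gmorph1 phiM; have phiV := gmorphV phiM.
have phiR g : phi [~ g, a] = (phi g)^-1 * (phi g) ^ s.
  by rewrite commgEl conjgE !phiM !phiV phia.
have phiRR g m : phi g = r ^+ m -> phi [~ [~ g, a], a] = r ^+ (m * 4).
  have : (r ^+ m) ^ s = (r ^+ m)^-1 by rewrite conjXg rs expVgn.
  rewrite !phiR expgnA => + -> ; move: (r ^+ m) => w ws.
  by rewrite ws conjMg conjVg ws invgM invgK !expgS expg0 !mulgA mulg1.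
have phiE : phi (iter 4 (fun g => [~ g, a]) y) = r ^+ 16.
  exact: (phiRR _ 4) (phiRR _ 1%N phiy).
have rE : (r i0 = i2) * (r i1 = i0) * (r i2 = i1).
  have i01 : i0 != i1 by rewrite -val_eqE /= !inordK.
  have i02 : i0 != i2 by rewrite -val_eqE /= !inordK.
  have i12 : i1 != i2 by rewrite -val_eqE /= !inordK.
  by rewrite !permM tpermL tpermR (tpermD i02 i12) tpermL tpermR tpermD 1?eq_sym.
(* As [r] is a 3-cycle, [r ^+ 16] is [r], which moves [i0]. *)
move=> e1; have : (r ^+ 16) i0 = i0 by rewrite -phiE e1 phi1 perm1.
rewrite permX /= !rE => /(congr1 val); by rewrite /= !inordK.
Qed.

Theorem corollary4p4 :
  lcs_length_ge G_K2 (ord_fin 5) /\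
  lcs_length_le G_K2 (ord_mul ord_omega ord_omega).
Proof.
exact: lcs_length_of_residual K2_residually_nilpotent (engel_mem_lcs a y 4) engel_K2_neq1.
Qed.
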